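(* Let $n \geq 1$ and let $A_1,\ldots,A_n \in \mathrm{SL}(2,\mathbb{R})$. Then $$ \frac{1}{2\pi}\int_0^{2\pi} N( A_n R_{\theta} \cdots A_1 R_{\theta} ) \, d\theta = \sum_{j=1}^{n} N(A_j). $$
   Context: $\mathrm{SL}(2,\mathbb{R})$ is the group of real $2\times 2$ matrices of determinant $1$. For a matrix $A$, $\|A\| = \sup_{v\neq 0} \|Av\|/\|v\|$ is the operator norm with respect to the Euclidean norm. For $A\in \mathrm{SL}(2,\mathbb{R})$, $$N(A)=\log\left(\frac{\|A\|+\|A\|^{-1}}{2}\right).$$ For $\theta\in\mathbb{R}$, $R_\theta=\begin{pmatrix}\cos\theta & -\sin\theta\\ \sin\theta & \cos\theta\end{pmatrix}$. The product $A_n R_\theta\cdots A_1R_\theta$ is $(A_nR_\theta)(A_{n-1}R_\theta)\cdots(A_1R_\theta)$. *)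

(* Defs.v *)
From HB Require Import structures.
From mathcomp Require Import all_boot all_order all_algebra.
From mathcomp Require Import all_classical all_reals all_analysis.

Set Implicit Arguments.
Unset Strict Implicit.
Unset Printing Implicit Defensive.

Import Order.TTheory GRing.Theory Num.Theory.
Import numFieldNormedType.Exports.

Local Open Scope classical_set_scope.
Local Open Scope ring_scope.

(* MathComp-Analysis equips matrices with the sup norm, so the Euclidean norm
   and its operator norm are defined here. *)
Definition eucl_norm (R : realType) (m : nat) (v : 'cV[R]_m) : R :=
  Num.sqrt (\sum_i v i 0 ^+ 2).

Definition op_norm (R : realType) (m : nat) (A : 'M[R]_m) : R :=
  sup [set eucl_norm (A *m v) / eucl_norm v | v in [set v : 'cV[R]_m | v != 0]].

Definition logN (R : realType) (A : 'M[R]_2) : R :=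
  ln ((op_norm A + (op_norm A)^-1) / 2).

Definition rotmx (R : realType) (theta : R) : 'M[R]_2 :=
  \matrix_(i, j) if i == j then cos theta
                 else if (i < j)%N then - sin theta else sin theta.

(* The list A_1, ..., A_n is indexed from 0; [rev_ord] puts the last matrix
   leftmost. *)
Definition rotmx_prod (R : realType) (n : nat) (A : 'I_n -> 'M[R]_2) (theta : R) :
    'M[R]_2 :=
  \prod_(j < n) (A (rev_ord j) * rotmx theta).

(* Main.v *)
(** Identify R^2 with C and write a real matrix as z |-> u z + v z^-, so that the
    determinant is |u|^2 - |v|^2; for determinant 1, N(A) = log |u|.  The rotation
    R_t has u = e^(it), v = 0, hence for the product A_n R_t ... A_1 R_t one has
    |u| = |P(e^(-2it))|, where P is a polynomial with P(0) = u_1 ... u_n.  Since each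
    A_j preserves the cone |u| > |v|, P has no zero in the closed unit disc, and
    the theorem is the mean value property of log |P|.  After factoring P, this
    reduces to the vanishing of J(a) = int_0^(2 pi) log |1 - a e^(-it)|^2 dt for
    |a| < 1.  From (1 - aw)(1 + aw) = 1 - a^2 w^2 one gets 2 J(a) = J(a^2); as J
    is bounded on smaller discs, J = 0. *)

Require Import Defs.
From HB Require Import structures.
From mathcomp Require Import all_boot all_order all_algebra.
From mathcomp Require Import all_classical all_reals all_analysis.
From mathcomp Require Import complex.
From mathcomp Require Import ring lra.

Set Implicit Arguments.
Unset Strict Implicit.
Unset Printing Implicit Defensive.

Import Order.TTheory GRing.Theory Num.Theory.
Import numFieldNormedType.Exports.

Local Open Scope classical_set_scope.
Local Open Scope ring_scope.

(** * Operator norm of a 2 x 2 matrix *)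

Lemma sum_ord2 (V : nmodType) (F : 'I_2 -> V) : \sum_i F i = F 0 + F 1.
Proof.
by rewrite big_ord_recl big_ord1; congr (_ + F _); exact: val_inj.
Qed.

Lemma eucl_norm2 (R : realType) (v : 'cV[R]_2) :
  eucl_norm v = Num.sqrt (v 0 0 ^+ 2 + v 1 0 ^+ 2).
Proof. by rewrite /eucl_norm sum_ord2. Qed.

Lemma det_mx2 (R : comNzRingType) (M : 'M[R]_2) :
  \det M = M 0 0 * M 1 1 - M 0 1 * M 1 0.
Proof.
rewrite (expand_det_row _ 0) sum_ord2 /cofactor !det_mx11 !mxE /=.
have -> : lift 0 0 = 1 :> 'I_2 by exact: val_inj.
have -> : lift 1 0 = 0 :> 'I_2 by exact: val_inj.
by rewrite addn0 add0n expr0 expr1 mul1r mulN1r mulrN.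
Qed.

Lemma mulmx_col2 (R : comNzRingType) (M : 'M[R]_2) (v : 'cV[R]_2) i :
  (M *m v) i 0 = M i 0 * v 0 0 + M i 1 * v 1 0.
Proof. by rewrite mxE sum_ord2. Qed.

(** By Cayley-Hamilton a symmetric 2 x 2 matrix of determinant 0 satisfies S^2 = tr(S) S, so the
    trace times the form is a sum of two squares. It is applied to t - M^T M, with t the top
    eigenvalue of M^T M. *)
Lemma singular_form_ge0 (R : realFieldType) (p q r x y : R) :
  p * r = q ^+ 2 -> 0 <= p + r -> 0 <= p * x ^+ 2 + 2 * q * x * y + r * y ^+ 2.
Proof.
move=> pr pr0.
(* If the trace vanishes, then - p^2 = q^2 forces the whole form to be zero. *)
have [tr0|tr0] := eqVneq (p + r) 0.
  have rE : r = - p by lra.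
  have := sqr_ge0 q; have := sqr_ge0 p; rewrite -pr rE => *.
  have p0 : p = 0 by apply/eqP; rewrite -sqrf_eq0; apply/eqP; nra.
  have q0 : q = 0 by apply/eqP; rewrite -sqrf_eq0 -pr p0 mul0r.
  by rewrite q0 p0; lra.
have {}tr0 : 0 < p + r by rewrite lt_def tr0.
rewrite -(pmulr_rge0 _ tr0).
have -> : (p + r) * (p * x ^+ 2 + 2 * q * x * y + r * y ^+ 2) =
   (p * x + q * y) ^+ 2 + (q * x + r * y) ^+ 2 + (p * r - q ^+ 2) * (x ^+ 2 + y ^+ 2).
  by ring.
by rewrite pr subrr mul0r addr0 addr_ge0// sqr_ge0.
Qed.

Lemma singular_form_null (R : realFieldType) (p q r : R) : p * r = q ^+ 2 ->
  exists xy : R * R, xy.1 ^+ 2 + xy.2 ^+ 2 != 0 /\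
    p * xy.1 ^+ 2 + 2 * q * xy.1 * xy.2 + r * xy.2 ^+ 2 = 0.
Proof.
move=> pr.
have [p0|p0] := eqVneq p 0.
  exists (1, 0); split => /=; first by rewrite expr1n expr0n addr0 oner_neq0.
  by rewrite p0; ring.
exists (q, - p) => /=; split.
  rewrite paddr_eq0 ?sqr_ge0// negb_and; apply/orP; right.
  by rewrite sqrrN sqrf_eq0.
have -> : p * q ^+ 2 + 2 * q * q * - p + r * (- p) ^+ 2 = p * (p * r - q ^+ 2) by ring.
by rewrite pr subrr mulr0.
Qed.

(** The squared norm is the larger eigenvalue of M^T M. As the determinant is 1, the other
    eigenvalue is its inverse, and the two add up to the trace. *)
Lemma op_norm_sqr_add_inv (R : realType) (M : 'M[R]_2) : \det M = 1 ->
  0 < op_norm M /\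
  op_norm M ^+ 2 + (op_norm M ^+ 2)^-1 =
    M 0 0 ^+ 2 + M 0 1 ^+ 2 + M 1 0 ^+ 2 + M 1 1 ^+ 2.
Proof.
rewrite det_mx2.
move: (M 0 0) (M 0 1) (M 1 0) (M 1 1) (mulmx_col2 M ^~ 0) (mulmx_col2 M ^~ 1).
move=> a b c d M0 M1 det1.
set S := _ + _ + _ + _.
(* This makes the discriminant [S ^+ 2 - 4] nonnegative. *)
have S2 : 2 <= S.
  rewrite -subr_ge0.
  have -> : S - 2 = (a - d) ^+ 2 + (b + c) ^+ 2 + 2 * ((a * d - b * c) - 1).
    by rewrite /S; ring.
  by rewrite det1 subrr mulr0 addr0 addr_ge0// sqr_ge0.
set D := Num.sqrt (S ^+ 2 - 4).
have D2 : D ^+ 2 = S ^+ 2 - 4 by rewrite sqr_sqrtr//; nra.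
have D0 : 0 <= D by exact: sqrtr_ge0.
(* [t] is the larger root of x^2 - S x + 1, the characteristic polynomial of M^T M; [p], [q], [r]
   are the entries of the singular matrix t - M^T M. *)
pose t := (S + D) / 2.
have t0 : 0 < t by rewrite /t; lra.
have tE : t ^+ 2 - S * t + 1 = 0.
  have -> : t ^+ 2 - S * t + 1 = (D ^+ 2 - (S ^+ 2 - 4)) / 4 by rewrite /t; field.
  by rewrite D2 subrr mul0r.
pose p := t - (a ^+ 2 + c ^+ 2); pose q := - (a * b + c * d).
pose r := t - (b ^+ 2 + d ^+ 2).
have pr : p * r = q ^+ 2.
  apply/eqP; rewrite -subr_eq0; apply/eqP.
  have -> : p * r - q ^+ 2 = (t ^+ 2 - S * t + 1) + ((a * d - b * c) ^+ 2 - 1).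
    by rewrite /p /q /r /S; ring.
  by rewrite tE det1 expr1n subrr addr0.
have form x y : p * x ^+ 2 + 2 * q * x * y + r * y ^+ 2 =
    t * (x ^+ 2 + y ^+ 2) - ((a * x + b * y) ^+ 2 + (c * x + d * y) ^+ 2).
  by rewrite /p /q /r; ring.
set E := [set eucl_norm (M *m v) / eucl_norm v | v in [set v : 'cV[R]_2 | v != 0]].
have EleT : ubound E (Num.sqrt t).
  move=> _ [v /= v0 <-].
  have vn0 : 0 < v 0 0 ^+ 2 + v 1 0 ^+ 2.
    rewrite lt_def addr_ge0 ?sqr_ge0// andbT paddr_eq0 ?sqr_ge0// !sqrf_eq0.
    apply: contra v0 => /andP[/eqP v00 /eqP v10]; apply/eqP/colP => i.
    rewrite mxE; case: i => -[|[|//]] lti.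
      by rewrite -[RHS]v00; congr (v _ _); exact: val_inj.
    by rewrite -[RHS]v10; congr (v _ _); exact: val_inj.
  rewrite !eucl_norm2 ler_pdivrMr ?sqrtr_gt0// -sqrtrM ?(ltW t0)// M0 M1.
  apply: ler_wsqrtr; rewrite -subr_ge0 -form singular_form_ge0//.
  by rewrite /p /r; move: D0; rewrite /t /S; lra.
(* A kernel vector of t - M^T M attains the bound. *)
have Et : E (Num.sqrt t).
  have [[x y]/= [xy0]] := singular_form_null pr; rewrite form => /eqP.
  rewrite subr_eq0 => /eqP xyE.
  pose v : 'cV[R]_2 := \col_i (if i == 0 then x else y).
  have vx : v 0 0 = x by rewrite mxE.
  have vy : v 1 0 = y by rewrite mxE.
  exists v => /=.
    apply: contra xy0 => /eqP v0.
    by rewrite -vx -vy v0 !mxE expr0n addr0.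
  rewrite !eucl_norm2 M0 M1 vx vy -xyE sqrtrM ?(ltW t0)// mulfK//.
  by rewrite sqrtr_eq0 -ltNge lt_def xy0 addr_ge0 ?sqr_ge0.
have -> : op_norm M = Num.sqrt t.
  apply/eqP; rewrite eq_le; apply/andP; split.
    by apply: ge_sup => //; exists (Num.sqrt t).
  by apply: ub_le_sup => //; exists (Num.sqrt t).
rewrite sqrtr_gt0 t0 sqr_sqrtr ?(ltW t0)//; split => //.
have tn0 : t != 0 by rewrite gt_eqF.
apply: (mulfI tn0); rewrite mulrDr divff//; apply/eqP.
by rewrite -subr_eq0 -tE; apply/eqP; ring.
Qed.

(** * Complex-linear and antilinear parts *)

Definition sqmod (R : realType) (z : R[i]) : R := complex.Re z ^+ 2 + complex.Im z ^+ 2.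

Lemma sqmodM (R : realType) (y z : R[i]) : sqmod (y * z) = sqmod y * sqmod z.
Proof. by case: y z => [a b] [c d]; rewrite /sqmod /=; ring. Qed.

Lemma sqmod_ge0 (R : realType) (z : R[i]) : 0 <= sqmod z.
Proof. by rewrite addr_ge0 ?sqr_ge0. Qed.

Lemma sqmod_eq0 (R : realType) (z : R[i]) : (sqmod z == 0) = (z == 0).
Proof. by rewrite paddr_eq0 ?sqr_ge0// !sqrf_eq0 eq_complex. Qed.

Lemma sqmod_gt0 (R : realType) (z : R[i]) : (0 < sqmod z) = (z != 0).
Proof. by rewrite lt_def sqmod_ge0 sqmod_eq0 andbT. Qed.

Lemma sqmod1 (R : realType) : sqmod (1 : R[i]) = 1.
Proof. by rewrite /sqmod /= expr1n expr0n addr0. Qed.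

Lemma sqmodV (R : realType) (z : R[i]) : sqmod z^-1 = (sqmod z)^-1.
Proof.
have [->|z0] := eqVneq z 0; first by rewrite invr0 /sqmod /= !expr0n addr0 invr0.
apply: (mulfI (_ : sqmod z != 0)); first by rewrite sqmod_eq0.
by rewrite -sqmodM divff// sqmod1 divff// sqmod_eq0.
Qed.

(* On C = R^2, [M] acts as [z |-> linpart M * z + antipart M * conjc z]. *)
Definition linpart (R : realType) (M : 'M[R]_2) : R[i] :=
  Complex ((M 0 0 + M 1 1) / 2) ((M 1 0 - M 0 1) / 2).

Definition antipart (R : realType) (M : 'M[R]_2) : R[i] :=
  Complex ((M 0 0 - M 1 1) / 2) ((M 1 0 + M 0 1) / 2).

Arguments linpart : simpl never.
Arguments antipart : simpl never.
Arguments conjc : simpl never.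

Lemma linpartM (R : realType) (M N : 'M[R]_2) :
  linpart (M * N) = linpart M * linpart N + antipart M * conjc (antipart N).
Proof.
by rewrite /linpart /antipart !mxE !sum_ord2; apply/eqP;
  rewrite eq_complex /=; apply/andP; split; apply/eqP; field.
Qed.

Lemma antipartM (R : realType) (M N : 'M[R]_2) :
  antipart (M * N) = linpart M * antipart N + antipart M * conjc (linpart N).
Proof.
by rewrite /linpart /antipart !mxE !sum_ord2; apply/eqP;
  rewrite eq_complex /=; apply/andP; split; apply/eqP; field.
Qed.

Lemma sqmod_linpart (R : realType) (M : 'M[R]_2) :
  sqmod (linpart M) - sqmod (antipart M) = \det M.
Proof. by rewrite det_mx2 /sqmod /=; field. Qed.

(** Expanding, 4 |u|^2 is the sum of the squared entries plus 2 det M, hence equals (s + 1/s)^2 for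
    s the operator norm. *)
Lemma logN_linpart (R : realType) (M : 'M[R]_2) : \det M = 1 ->
  logN M = ln (sqmod (linpart M)) / 2.
Proof.
move=> det1; have [s0 sE] := op_norm_sqr_add_inv det1.
have sV0 : 0 < (op_norm M + (op_norm M)^-1) / 2.
  by rewrite divr_gt0// addr_gt0// invr_gt0.
suff -> : sqmod (linpart M) = ((op_norm M + (op_norm M)^-1) / 2) ^+ 2.
  by rewrite lnXn// -[ln _ *+ 2]mulr_natr mulfK// pnatr_eq0.
have sn0 : op_norm M != 0 by rewrite gt_eqF.
have -> : ((op_norm M + (op_norm M)^-1) / 2) ^+ 2 =
    (op_norm M ^+ 2 + (op_norm M ^+ 2)^-1 + 2 * 1) / 4 by field.
by rewrite sE -[X in _ + 2 * X]det1 det_mx2 /sqmod /=; field.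
Qed.

(** * Rotations and the polynomial of the product *)

Definition unitc (R : realType) (t : R) : R[i] := Complex (cos t) (- sin t).

Lemma unitcD (R : realType) (s t : R) : unitc (s + t) = unitc s * unitc t.
Proof.
apply/eqP; rewrite eq_complex /= cosD sinD.
by apply/andP; split; apply/eqP; ring.
Qed.

Lemma unitc_pi (R : realType) : unitc (pi : R) = -1.
Proof. by apply/eqP; rewrite eq_complex /= cospi sinpi !oppr0 !eqxx. Qed.

Lemma unitcD2pi (R : realType) (t : R) : unitc (t + 2 * pi) = unitc t.
Proof. by rewrite mulr_natl mulr2n unitcD unitcD unitc_pi mulrNN !mulr1. Qed.

Lemma unitc_double (R : realType) (t : R) : unitc (2 * t) = unitc t ^+ 2.
Proof. by rewrite mulr_natl mulr2n unitcD. Qed.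

Lemma linpart_rotmx (R : realType) (t : R) : linpart (rotmx t) = conjc (unitc t).
Proof.
by rewrite /linpart !mxE /=; apply/eqP; rewrite eq_complex /=;
  apply/andP; split; apply/eqP; field.
Qed.

Lemma antipart_rotmx (R : realType) (t : R) : antipart (rotmx t) = 0.
Proof.
by rewrite /antipart !mxE /=; apply/eqP; rewrite eq_complex /=;
  apply/andP; split; apply/eqP; field.
Qed.

Lemma sqmod_unitc (R : realType) (t : R) : sqmod (unitc t) = 1.
Proof. by rewrite /sqmod /= sqrrN cos2Dsin2. Qed.

Lemma sqmod_conjc (R : realType) (z : R[i]) : sqmod (conjc z) = sqmod z.
Proof. by case: z => a b; rewrite /sqmod /= sqrrN. Qed.

Lemma conjc_unitcK (R : realType) (t : R) : conjc (unitc t) * unitc t = 1.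
Proof.
have := cos2Dsin2 t => cs.
by apply/eqP; rewrite eq_complex /=; apply/andP; split; apply/eqP; rewrite -?cs; ring.
Qed.

(* For [w = exp (- 2 i t)], and up to a common factor of modulus 1, the values at
   [w] are the linear part and the conjugate antilinear part of the product of
   the [M * rotmx t]: see [prodpoly_rotmx]. *)
Fixpoint prodpoly (R : realType) (s : seq 'M[R]_2) : {poly R[i]} * {poly R[i]} :=
  if s is M :: s' then
    let: (X, Y) := prodpoly s' in
    ((linpart M)%:P * X + (antipart M)%:P * ('X * Y),
     (conjc (antipart M))%:P * X + (conjc (linpart M))%:P * ('X * Y))
  else (1, 0).

(** The linear and antilinear parts of [M * rotmx t] are u e^(it) and v e^(-it). Pulling e^(it) out
    at each step leaves e^(-2it) on the antilinear term, and [k] collects the factors e^(it).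
    Conjugating the antilinear part makes the recursion complex-linear. *)
Lemma prodpoly_rotmx (R : realType) (s : seq 'M[R]_2) (t : R) :
  exists2 k : R[i], sqmod k = 1 &
    linpart (\prod_(M <- s) (M * rotmx t)) = k * (prodpoly s).1.[unitc t ^+ 2] /\
    conjc (antipart (\prod_(M <- s) (M * rotmx t))) = k * (prodpoly s).2.[unitc t ^+ 2].
Proof.
elim: s => [|M s [k k1 [IHl IHa]]] /=.
  exists 1; first exact: sqmod1.
  rewrite big_nil hornerC horner0 mulr1 mulr0 /linpart /antipart !mxE /=.
  split; apply/eqP; rewrite eq_complex /=; apply/andP; split; apply/eqP; by field.
case: (prodpoly s) IHl IHa => X Y /= IHl IHa.
exists (conjc (unitc t) * k); first by rewrite sqmodM k1 sqmod_conjc sqmod_unitc mulr1.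
rewrite big_cons !hornerE; set P := \prod_(N <- s) _ in IHl IHa *.
have uV := conjc_unitcK t.
rewrite !(linpartM, antipartM) linpart_rotmx antipart_rotmx.
rewrite conjc0 !mulr0 addr0 add0r.
rewrite rmorphD !rmorphM /= !conjcK IHl IHa.
set z := unitc t in uV *; set zb := conjc z in uV *; set x := X.[_]; set y := Y.[_].
have key u v : u * zb * (k * x) + v * z * (k * y) =
    zb * k * (u * x + v * z * z * y).
  apply/eqP; rewrite -subr_eq0; apply/eqP.
  have -> : u * zb * (k * x) + v * z * (k * y) - zb * k * (u * x + v * z * z * y)
      = (1 - zb * z) * (v * z * k * y) by ring.
  by rewrite uV subrr mul0r.
by split; [|rewrite addrC]; exact: key.
Qed.

(** The pair (X, wY) is acted on by the matrix with rows (u, v) and (v^-, u^-), which multiplies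
    |x|^2 - |y|^2 by |u|^2 - |v|^2 = det M = 1. Since |w| <= 1, replacing Y by wY keeps the strict
    inequality. *)
Lemma prodpoly_cone (R : realType) (s : seq 'M[R]_2) (w : R[i]) :
  (forall M, M \in s -> \det M = 1) -> sqmod w <= 1 ->
  sqmod (prodpoly s).2.[w] < sqmod (prodpoly s).1.[w].
Proof.
elim: s => [|M s IH] dets w1 /=; first by rewrite !hornerC sqmod1 /sqmod /= !expr0n addr0.
have {}IH := IH (fun N Ns => dets N (mem_behead (s := M :: s) Ns)) w1.
case: (prodpoly s) IH => X Y /= IH.
have detM : \det M = 1 by apply: dets; rewrite mem_head.
rewrite !hornerE -subr_gt0.
have key (x y u v : R[i]) :
    sqmod (u * x + v * w * y) - sqmod (conjc v * x + conjc u * w * y) =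
    (sqmod u - sqmod v) * (sqmod x - sqmod w * sqmod y).
  case: x y u v w {w1 IH} => [x1 x2] [y1 y2] [u1 u2] [v1 v2] [w1 w2].
  by rewrite /conjc /sqmod /=; ring.
rewrite [X in 0 < X](key X.[w] Y.[w] (linpart M) (antipart M)).
rewrite sqmod_linpart detM mul1r subr_gt0; apply: le_lt_trans IH.
by rewrite ler_piMl// sqmod_ge0.
Qed.

Lemma prodpoly0 (R : realType) (s : seq 'M[R]_2) :
  (prodpoly s).1.[0] = \prod_(M <- s) linpart M.
Proof.
elim: s => [|M s] /=; first by rewrite big_nil hornerC.
rewrite big_cons; case: (prodpoly s) => X Y /= <-.
by rewrite hornerD !hornerCM hornerM hornerX mul0r mulr0 addr0.
Qed.

(** * Integrals of periodic functions *)

Lemma continuous_add (R : realType) (f g : R -> R) : continuous f -> continuous g ->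
  continuous (fun t => f t + g t).
Proof. by move=> cf cg t; apply: continuousD; [exact: cf|exact: cg]. Qed.

Lemma continuous_scale (R : realType) (f : R -> R) (c : R) : continuous f ->
  continuous (fun t => c * f t).
Proof. by move=> cf t; apply: continuousM; [exact: cvg_cst|exact: cf]. Qed.

Lemma continuous_comp_scale (R : realType) (f : R -> R) (c : R) : continuous f ->
  continuous (fun t : R => f (c * t)).
Proof.
move=> cf t; apply: (@continuous_comp R R R (fun y : R => c * y) f); last exact: cf.
by apply: continuousM; [exact: cvg_cst|exact: cvg_id].
Qed.

Lemma continuous_comp_shift (R : realType) (f : R -> R) (c : R) : continuous f ->
  continuous (fun t : R => f (t + c)).
Proof.
move=> cf t; apply: (@continuous_comp R R R (fun y : R => y + c) f); last exact: cf.
by apply: continuousD; [exact: cvg_id|exact: cvg_cst].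
Qed.

Lemma antiderivative (R : realType) (f : R -> R) (c : R) : continuous f ->
  exists F : R -> R, forall x, c < x -> is_derive x 1 F (f x).
Proof.
move=> cf; exists (fun x => \int[lebesgue_measure]_(t in `[c, x]) f t) => x cx.
have xx1 : x < x + 1 by rewrite ltrDl.
have := @continuous_FTC1_closed R f c x (x + 1) xx1.
case=> //.
- apply: continuous_compact_integrable; first exact: segment_compact.
  by apply: continuous_subspaceT.
- exact: cf.
move=> dF F'; apply: DeriveDef; first exact: dF.
by rewrite -derive1E F'.
Qed.

Lemma integral_antiderivative (R : realType) (f F : R -> R) (a b : R) : a < b ->
  continuous f -> (forall x, a <= x -> is_derive x 1 F (f x)) ->
  (\int[@lebesgue_measure R]_(x in `[a, b]) (f x)%:E = (F b - F a)%:E)%E.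
Proof.
move=> ab cf dF.
have cF x : a <= x -> {for x, continuous F}.
  by move=> /dF dFx; apply/differentiable_continuous/derivable1_diffP.
rewrite (continuous_FTC2 (F := F)) ?EFinB//.
- exact: continuous_subspaceT.
- split.
  + by move=> x; rewrite in_itv/= => /andP[/ltW/dF].
  + exact/cvg_at_right_filter/cF.
  + by apply/cvg_at_left_filter/cF/ltW.
- move=> x; rewrite in_itv/= => /andP[/ltW/dF dFx _].
  by rewrite derive1E; apply: derive_val.
Qed.

Lemma is_derive1_shift (R : realType) (F : R -> R) (c x d : R) :
  is_derive (x + c) 1 F d -> is_derive x 1 (fun y => F (y + c)) d.
Proof.
move=> dF; rewrite -[d]mulr1.
apply: (@is_derive1_comp R F (fun y => y + c) x d 1 dF).
by rewrite -[X in is_derive _ _ _ X]addr0; exact: is_deriveD.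
Qed.

(** Both x |-> F(x + p) and F are antiderivatives of f on [0, c], so their increments there agree;
    this turns F(p + c) - F(c) into F(p) - F(0). *)
Lemma integral_shift_period (R : realType) (f : R -> R) (p c : R) : 0 < p -> 0 <= c ->
  continuous f -> (forall x, f (x + p) = f x) ->
  (\int[@lebesgue_measure R]_(x in `[0%R, p]) (f (x + c))%:E =
   \int[@lebesgue_measure R]_(x in `[0%R, p]) (f x)%:E)%E.
Proof.
move=> p0; rewrite le_eqVlt => /predU1P[<- _ _|c0 cf fp].
  by under eq_integral do rewrite addr0.
(* Starting the integral at -1 gives [F] a two-sided derivative on all of [0, +oo), the endpoint 0
   included. *)
have [F dF] := antiderivative (-1) cf.
have dF0 (x : R) : 0 <= x -> is_derive x 1 F (f x) by move=> x0; apply: dF; lra.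
have dFs (q x : R) : 0 <= q -> 0 <= x -> is_derive x 1 (fun y => F (y + q)) (f (x + q)).
  by move=> q0 x0; apply/is_derive1_shift/dF0/addr_ge0.
rewrite (integral_antiderivative p0 cf dF0).
have cfc := continuous_comp_shift (c := c) cf.
rewrite (integral_antiderivative p0 cfc (fun x => dFs c x (ltW c0))).
have dFp (x : R) : 0 <= x -> is_derive x 1 (fun y => F (y + p)) (f x).
  by move=> /(dFs _ _ (ltW p0)); rewrite fp.
have := integral_antiderivative c0 cf dF0.
rewrite (integral_antiderivative c0 cf dFp) => -[].
rewrite !add0r [p + c]addrC => FE; congr (_%:E); lra.
Qed.

(** The antiderivative F(2x)/2 gives half the integral of f over [0, 2p], that is, over two periods
    with equal contributions. *)
Lemma integral_double_period (R : realType) (f : R -> R) (p : R) : 0 < p ->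
  continuous f -> (forall x, f (x + p) = f x) ->
  (\int[@lebesgue_measure R]_(x in `[0%R, p]) (f (2 * x))%:E =
   \int[@lebesgue_measure R]_(x in `[0%R, p]) (f x)%:E)%E.
Proof.
move=> p0 cf fp; have [F dF] := antiderivative (-1) cf.
have dF0 (x : R) : 0 <= x -> is_derive x 1 F (f x) by move=> x0; apply: dF; lra.
have cf2 := continuous_comp_scale (c := 2) cf.
have dF2 (x : R) : 0 <= x -> is_derive x 1 (fun y => 2^-1 * F (2 * y)) (f (2 * x)).
  move=> x0; have d2 : is_derive x 1 (fun y : R => 2 * y) 2.
    by rewrite -[X in is_derive _ _ _ X]mulr1; exact: is_deriveZ.
  have x20 : 0 <= 2 * x by rewrite mulr_ge0.
  apply: (is_derive_eq (is_deriveZ 2^-1 (is_derive1_comp (dF0 _ x20) d2))).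
  by rewrite [f _ * 2]mulrC scalerA mulVf ?scale1r// pnatr_eq0.
rewrite (integral_antiderivative p0 cf dF0) (integral_antiderivative p0 cf2 dF2).
have dFp (x : R) : 0 <= x -> is_derive x 1 (fun y => F (y + p)) (f x).
  by rewrite -[f x]fp => x0; apply/is_derive1_shift/dF0; lra.
have := integral_antiderivative p0 cf dF0.
rewrite (integral_antiderivative p0 cf dFp) => -[].
rewrite !add0r mulr0 (_ : 2 * p = p + p); last by ring.
by move=> FE; congr (_%:E); lra.
Qed.

(** * Mean value property *)

Definition circint (R : realType) (f : R -> R) : R :=
  \int[@lebesgue_measure R]_(t in `[0, 2 * pi]) f t.

Lemma twopi_gt0 (R : realType) : 0 < 2 * pi :> R.
Proof. by rewrite mulr_gt0// pi_gt0. Qed.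

Lemma continuous_circ_integrable (R : realType) (f : R -> R) : continuous f ->
  (@lebesgue_measure R).-integrable `[0, 2 * pi] (EFin \o f).
Proof.
move=> cf; apply: continuous_compact_integrable; first exact: segment_compact.
exact: continuous_subspaceT.
Qed.

Lemma circint_cst (R : realType) (c : R) : circint (fun=> c) = 2 * pi * c.
Proof.
have mE : @lebesgue_measure R `[0, 2 * pi]%classic = (2 * pi)%:E.
  by rewrite lebesgue_measure_itv/= lte_fin twopi_gt0 -EFinB subr0.
rewrite mulrC /circint; apply: eq_trans (Rintegral_cst _ _ _) _ => //.
by congr (_ * _); exact: (congr1 fine mE).
Qed.

Lemma circintD (R : realType) (f g : R -> R) : continuous f -> continuous g ->
  circint (fun t => f t + g t) = circint f + circint g.
Proof. by move=> cf cg; apply: RintegralD => //; exact: continuous_circ_integrable. Qed.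

Lemma le_circint (R : realType) (f g : R -> R) : continuous f -> continuous g ->
  (forall t, f t <= g t) -> circint f <= circint g.
Proof.
by move=> cf cg fg; apply: le_Rintegral => //; exact: continuous_circ_integrable.
Qed.

Lemma circint_shift (R : realType) (f : R -> R) (c : R) : 0 <= c -> continuous f ->
  (forall t, f (t + 2 * pi) = f t) -> circint (fun t => f (t + c)) = circint f.
Proof.
by move=> c0 cf fp; rewrite /circint /Rintegral integral_shift_period// twopi_gt0.
Qed.

Lemma circint_double (R : realType) (f : R -> R) : continuous f ->
  (forall t, f (t + 2 * pi) = f t) -> circint (fun t => f (2 * t)) = circint f.
Proof.
by move=> cf fp; rewrite /circint /Rintegral integral_double_period// twopi_gt0.
Qed.

(** * Logarithms of linear factors on the unit circle *)

Lemma sqmod_1B_ge (R : realType) (z : R[i]) : sqmod z <= 1 ->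
  (1 - Num.sqrt (sqmod z)) ^+ 2 <= sqmod (1 - z).
Proof.
move=> z1; have s0 := sqmod_ge0 z; set s := Num.sqrt (sqmod z).
have s2 : s ^+ 2 = sqmod z by rewrite sqr_sqrtr.
(* Once squared, the reverse triangle inequality amounts to Re z <= |z|. *)
have zs : complex.Re z <= s.
  apply: (le_trans (ler_norm _)); rewrite -sqrtr_sqr; apply: ler_wsqrtr.
  by rewrite lerDl sqr_ge0.
rewrite -subr_ge0.
have -> : sqmod (1 - z) - (1 - s) ^+ 2 = 2 * (s - complex.Re z) + (sqmod z - s ^+ 2).
  by case: z {z1 s0 zs s2} @s => x y s; rewrite /sqmod /=; ring.
by rewrite s2 subrr addr0 mulr_ge0// subr_ge0.
Qed.

Lemma sqmod_1B_gt0 (R : realType) (z : R[i]) : sqmod z < 1 -> 0 < sqmod (1 - z).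
Proof.
move=> z1; rewrite sqmod_gt0 subr_eq0; apply: contraTneq z1 => <-.
by rewrite sqmod1 ltxx.
Qed.

Lemma sqmod_1B_le (R : realType) (z : R[i]) : sqmod z <= 1 -> sqmod (1 - z) <= 4.
Proof.
(* Parallelogram law for 1 and z. *)
have -> : sqmod (1 - z) = 2 + 2 * sqmod z - sqmod (1 + z).
  by case: z => x y; rewrite /sqmod /=; ring.
by have := sqmod_ge0 (1 + z); lra.
Qed.

(** This is twice log |1 - a e^(-it)|, a form without square roots. *)
Definition lnfactor (R : realType) (a : R[i]) (t : R) : R :=
  ln (sqmod (1 - a * unitc t)).

Lemma sqmod_factor_gt0 (R : realType) (a : R[i]) (t : R) : sqmod a < 1 ->
  0 < sqmod (1 - a * unitc t).
Proof. by move=> a1; rewrite sqmod_1B_gt0// sqmodM sqmod_unitc mulr1. Qed.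

Lemma continuous_lnfactor (R : realType) (a : R[i]) : sqmod a < 1 ->
  continuous (lnfactor a).
Proof.
move=> a1 t; apply: (@continuous_comp R R R (fun t => sqmod (1 - a * unitc t)) (@ln R));
  last by apply: continuous_ln; exact: sqmod_factor_gt0.
(* Since |e^(-it)| = 1, the squared modulus is a trigonometric polynomial of degree at most 1. *)
rewrite (_ : (fun t => _) = (fun t => 1 + sqmod a -
    (2 * complex.Re a * cos t + 2 * complex.Im a * sin t))).
  apply: (@continuousB _ R^o); first exact: cvg_cst.
  by apply: (@continuousD _ R^o); apply: continuousM;
    [exact: cvg_cst|exact: continuous_cos|exact: cvg_cst|exact: continuous_sin].
apply/funext => s; have := cos2Dsin2 s.
case: a {a1} => x y; rewrite /sqmod /=.
move: (cos s) (sin s) => c d /eqP; rewrite -subr_eq0 => /eqP cd.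
apply/eqP; rewrite -subr_eq0; apply/eqP.
transitivity ((x ^+ 2 + y ^+ 2) * (c ^+ 2 + d ^+ 2 - 1)); first by ring.
by rewrite cd mulr0.
Qed.

Lemma lnfactorD2pi (R : realType) (a : R[i]) (t : R) :
  lnfactor a (t + 2 * pi) = lnfactor a t.
Proof. by rewrite /lnfactor unitcD2pi. Qed.

Lemma lnfactor_double (R : realType) (a : R[i]) (t : R) : sqmod a < 1 ->
  lnfactor a t + lnfactor a (t + pi) = lnfactor (a ^+ 2) (2 * t).
Proof.
move=> a1; rewrite /lnfactor -lnM ?posrE ?sqmod_factor_gt0// -sqmodM.
by rewrite unitcD unitc_pi unitc_double; congr (ln (sqmod _)); ring.
Qed.

(** In [lnfactor_double] both terms on the left integrate to J(a), by translation by pi, and the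
    right side integrates to J(a^2), by doubling the angle; both use the period 2 pi. *)
Lemma circint_lnfactor_sqr (R : realType) (a : R[i]) : sqmod a < 1 ->
  2 * circint (lnfactor a) = circint (lnfactor (a ^+ 2)).
Proof.
move=> a1.
have a21 : sqmod (a ^+ 2) < 1 by rewrite expr2 sqmodM mulr_ilt1// sqmod_ge0.
rewrite -(circint_double (continuous_lnfactor a21) (lnfactorD2pi _)).
have cs := continuous_comp_shift (c := pi) (continuous_lnfactor a1).
rewrite (_ : (fun t => lnfactor (a ^+ 2) (2 * t)) =
    (fun t => lnfactor a t + lnfactor a (t + pi))); last first.
  by apply/funext => t; rewrite lnfactor_double.
rewrite circintD//; last exact: continuous_lnfactor.
rewrite circint_shift ?pi_ge0//; last 2 first.
- exact: continuous_lnfactor.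
- exact: lnfactorD2pi.
by rewrite mulr_natl mulr2n.
Qed.

(** For |a|^2 <= r one has (1 - sqrt r)^2 <= |1 - a e^(-it)|^2 <= 4 pointwise, which bounds the
    logarithm independently of a. *)
Lemma circint_lnfactor_bounded (R : realType) (r : R) : r < 1 ->
  exists C : R, forall a : R[i], sqmod a <= r -> `|circint (lnfactor a)| <= C.
Proof.
move=> r1; pose l := ln ((1 - Num.sqrt r) ^+ 2).
exists (2 * pi * (`|l| + `|ln 4|)) => a ar.
have a1 : sqmod a < 1 by exact: le_lt_trans r1.
have cl := continuous_lnfactor a1.
have cc (c : R) : continuous (fun _ : R => c) by move=> t; exact: cvg_cst.
have r0 : 0 <= r by exact: le_trans (sqmod_ge0 a) ar.
have sr1 : Num.sqrt r < 1 by rewrite -sqrtr1 ltr_sqrt.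
have lo t : l <= lnfactor a t.
  have az1 : sqmod (a * unitc t) <= 1 by rewrite sqmodM sqmod_unitc mulr1 ltW.
  rewrite ler_ln ?posrE ?sqmod_factor_gt0//; last by rewrite exprn_gt0// subr_gt0.
  apply: le_trans (sqmod_1B_ge az1); rewrite ler_sqr ?nnegrE ?subr_ge0 ?(ltW sr1)//.
    by rewrite lerB// ler_wsqrtr// sqmodM sqmod_unitc mulr1.
  by rewrite -sqrtr1 ler_wsqrtr.
have up t : lnfactor a t <= ln 4.
  rewrite ler_ln ?posrE ?sqmod_factor_gt0// sqmod_1B_le//.
  by rewrite sqmodM sqmod_unitc mulr1 ltW.
rewrite ler_norml -mulrN -!circint_cst; apply/andP; split; apply: le_circint => // t.
  have := lo t; have := ler_norm (- l); have := normr_ge0 (ln 4 : R).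
  by rewrite normrN; lra.
by have := up t; have := ler_norm (ln 4 : R); have := normr_ge0 l; lra.
Qed.

(* The integral doubles when [a] is replaced by [a ^+ 2], but stays bounded. *)
Lemma circint_lnfactor (R : realType) (a : R[i]) : sqmod a < 1 ->
  circint (lnfactor a) = 0.
Proof.
move=> a1; have [C aC] := circint_lnfactor_bounded a1.
(* The second conjunct keeps every iterate in the disc on which the single bound [C] holds. *)
have iterE k : 2 ^+ k * circint (lnfactor a) = circint (lnfactor (a ^+ (2 ^ k)%N)) /\
    sqmod (a ^+ (2 ^ k)%N) <= sqmod a.
  elim: k => [|k [IH le]]; first by rewrite expr0 mul1r expn0 expr1.
  rewrite exprS -mulrA IH expnSr exprM circint_lnfactor_sqr ?(le_lt_trans le)//.
  split=> //; apply: (le_trans _ le).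
  by rewrite expr2 sqmodM ler_piMl ?sqmod_ge0// (le_trans _ (ltW a1)).
apply/eqP; rewrite -normr_le0 leNgt; apply/negP => J0.
(* The exponent k is chosen so that 2^k exceeds C / |J(a)|, against |2^k J(a)| <= C. *)
have [Jk ak] := iterE (Num.bound (C / `|circint (lnfactor a)|)).
have := aC _ ak; rewrite -Jk normrM ger0_norm ?exprn_ge0// -ler_pdivlMr//.
by rewrite leNgt upper_nthrootP.
Qed.

(** * Polynomials without zeros in the closed unit disc *)

Lemma prod_factors_horner (R : realType) (r : seq R[i]) (w : R[i]) : 0 \notin r ->
  (\prod_(z <- r) ('X - z%:P)).[w] =
  (\prod_(z <- r) ('X - z%:P)).[0] * \prod_(a <- r) (1 - a^-1 * w).
Proof.
elim: r => [|z r IH]; first by rewrite !big_nil !hornerC mulr1.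
rewrite in_cons negb_or => /andP[z0 /IH rE].
rewrite !big_cons !hornerM rE !hornerXsubC sub0r.
(* Each root contributes - z, and these factors gather into the value at 0. *)
have -> : w - z = - z * (1 - z^-1 * w) by field; rewrite eq_sym.
by rewrite !mulrA; congr (_ * _); rewrite -!mulrA; congr (_ * _); rewrite mulrC.
Qed.

Lemma sqmod_prod (R : realType) (I : Type) (s : seq I) (F : I -> R[i]) :
  sqmod (\prod_(i <- s) F i) = \prod_(i <- s) sqmod (F i).
Proof. exact: (big_morph _ (@sqmodM R) (sqmod1 R)). Qed.

(** The roots of P lie outside the closed disc, so their inverses, which form the list, lie in the
    open disc. Normalizing at 0 absorbs the leading coefficient. *)
Lemma ln_sqmod_horner (R : realType) (P : {poly R[i]}) :
  (forall w, sqmod w <= 1 -> P.[w] != 0) ->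
  exists2 r : seq R[i], (forall a, a \in r -> sqmod a < 1) &
    forall t, ln (sqmod P.[unitc t]) =
      ln (sqmod P.[0]) + \sum_(a <- r) lnfactor a t.
Proof.
move=> Pn0; have [r PE] := closed_field_poly_normal P.
have r1 z : z \in r -> 1 < sqmod z.
  move=> zr; rewrite ltNge; apply/negP => /Pn0/negP; apply.
  rewrite PE hornerZ (_ : _.[z] = 0) ?mulr0//; apply/eqP.
  by rewrite -[_ == 0]/(root _ z) root_prod_XsubC.
have rn0 : 0 \notin r.
  by apply/negP => /r1; rewrite /sqmod /= !expr0n addr0 ltr10.
have rV a : a \in map GRing.inv r -> sqmod a < 1.
  by move=> /mapP[z zr ->]; rewrite sqmodV invf_lt1 ?r1// (lt_trans _ (r1 z zr)).
exists (map GRing.inv r) => // t.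
have fgt0 a : a \in map GRing.inv r -> 0 < sqmod (1 - a * unitc t).
  by move=> /rV; exact: sqmod_factor_gt0.
have P0 : 0 < sqmod P.[0] by rewrite sqmod_gt0 Pn0// /sqmod /= !expr0n addr0.
have -> : P.[unitc t] = P.[0] * \prod_(a <- map GRing.inv r) (1 - a * unitc t).
  by rewrite big_map {1 2}PE !hornerZ prod_factors_horner// mulrA.
rewrite sqmodM sqmod_prod lnM ?posrE//; last by rewrite big_seq prodr_gt0.
congr (_ + _); elim: (map _ r) fgt0 => [|a s IH] sgt0; first by rewrite !big_nil ln1.
have sgt0' b : b \in s -> 0 < sqmod (1 - b * unitc t).
  by move=> bs; apply: sgt0; rewrite in_cons bs orbT.
rewrite !big_cons lnM ?posrE ?IH//; first by rewrite sgt0// mem_head.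
by rewrite big_seq prodr_gt0.
Qed.

(** Continuity is carried through the induction because [circintD] asks for it on both summands. *)
Lemma circint_sum_lnfactor (R : realType) (r : seq R[i]) :
  (forall a, a \in r -> sqmod a < 1) ->
  continuous (fun t => \sum_(a <- r) lnfactor a t) /\
  circint (fun t => \sum_(a <- r) lnfactor a t) = 0.
Proof.
elim: r => [_|a r IH rlt1].
  rewrite (_ : (fun t => _) = fun=> 0); last by apply/funext => t; rewrite big_nil.
  by split; [move=> t; exact: cvg_cst|rewrite circint_cst mulr0].
have a1 : sqmod a < 1 by rewrite rlt1// mem_head.
have [cr r0] : continuous (fun t => \sum_(b <- r) lnfactor b t) /\
    circint (fun t => \sum_(b <- r) lnfactor b t) = 0.
  by apply: IH => b br; rewrite rlt1// in_cons br orbT.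
have ca := continuous_lnfactor a1.
rewrite (_ : (fun t => _) = fun t => lnfactor a t + \sum_(b <- r) lnfactor b t);
  last by apply/funext => t; rewrite big_cons.
split; first exact: continuous_add.
by rewrite circintD// circint_lnfactor// r0 addr0.
Qed.

(** * From the product polynomial to the integral formula *)

Lemma det_rotmx (R : realType) (t : R) : \det (rotmx t) = 1.
Proof.
rewrite -sqmod_linpart linpart_rotmx antipart_rotmx sqmod_conjc sqmod_unitc.
by rewrite /sqmod /= !expr0n addr0 subr0.
Qed.

Lemma det_prod_rotmx (R : realType) (s : seq 'M[R]_2) (t : R) :
  (forall M, M \in s -> \det M = 1) -> \det (\prod_(M <- s) (M * rotmx t)) = 1.
Proof.
elim: s => [|M s IH] dets; first by rewrite big_nil det1.
rewrite big_cons !det_mulmx det_rotmx dets ?mem_head// !mul1r IH// => N Ns.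
by rewrite dets// in_cons Ns orbT.
Qed.

(** Each |u|^2 = 1 + |v|^2 is positive, so the logarithms add up. *)
Lemma ln_prod_linpart (R : realType) (s : seq 'M[R]_2) :
  (forall M, M \in s -> \det M = 1) ->
  ln (sqmod (\prod_(M <- s) linpart M)) = 2 * \sum_(M <- s) logN M.
Proof.
elim: s => [|M s IH] dets; first by rewrite !big_nil sqmod1 ln1 mulr0.
have detM : \det M = 1 by rewrite dets// mem_head.
have detS N : N \in s -> \det N = 1 by move=> Ns; rewrite dets// in_cons Ns orbT.
have gt0 N : N \in M :: s -> 0 < sqmod (linpart N).
  by move=> /dets; rewrite -sqmod_linpart; have := sqmod_ge0 (antipart N); lra.
rewrite !big_cons sqmodM lnM ?posrE ?gt0 ?mem_head//.
  by rewrite IH// logN_linpart// mulrDr [2 * (_ / 2)]mulrC divfK// pnatr_eq0.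
rewrite sqmod_prod big_seq prodr_gt0// => N Ns.
by rewrite gt0// in_cons Ns orbT.
Qed.

Lemma integral_logN_prod (R : realType) (s : seq 'M[R]_2) :
  (forall M, M \in s -> \det M = 1) ->
  (\int[@lebesgue_measure R]_(t in `[0%R, (2 * pi)%R])
     (logN (\prod_(M <- s) (M * rotmx t)))%:E =
   (2 * pi * \sum_(M <- s) logN M)%:E)%E.
Proof.
move=> dets; pose P := (prodpoly s).1.
have Pn0 w : sqmod w <= 1 -> P.[w] != 0.
  move=> w1; rewrite -sqmod_gt0; apply: le_lt_trans (prodpoly_cone dets w1).
  exact: sqmod_ge0.
have [r r1 PE] := ln_sqmod_horner Pn0.
pose g (t : R) := \sum_(a <- r) lnfactor a t.
have [cg g0] : continuous g /\ circint g = 0 := circint_sum_lnfactor r1.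
set S := \sum_(M <- s) logN M.
(* P is evaluated at e^(-2it), hence the angle [2 * t]; the factor 1/2 passes from the squared
   modulus to the modulus. *)
have logE t : logN (\prod_(M <- s) (M * rotmx t)) = S + 2^-1 * g (2 * t).
  rewrite logN_linpart; last exact: det_prod_rotmx.
  have [k k1 [-> _]] := prodpoly_rotmx s t.
  rewrite sqmodM k1 mul1r -unitc_double PE prodpoly0 ln_prod_linpart//.
  by rewrite mulrDl mulrC mulKf ?pnatr_eq0// [_^-1 * _]mulrC.
under eq_integral do rewrite logE.
have gp t : g (t + 2 * pi) = g t.
  by apply: eq_bigr => a _; exact: lnfactorD2pi.
have cg2 := continuous_comp_scale (c := 2) cg.
have ch := continuous_scale (c := 2^-1) cg2.
have cS : continuous (fun _ : R => S) by move=> x; exact: cvg_cst.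
have cf := continuous_add cS ch.
have fE : circint (fun t => S + 2^-1 * g (2 * t)) = 2 * pi * S.
  rewrite circintD// circint_cst [X in _ + X](_ : _ = 0) ?addr0//.
  rewrite /circint RintegralZl//; last exact: continuous_circ_integrable.
  by rewrite -[X in _ * X]/(circint (fun t => g (2 * t))) circint_double// g0 mulr0.
(* [circint] is the finite part of the extended real integral; integrability shows that nothing is
   lost. *)
rewrite -fE /circint /Rintegral fineK//.
by apply: integrable_fin_num => //; exact: continuous_circ_integrable.
Qed.

Theorem theorem1 (R : realType) (n : nat) (hn : (1 <= n)%N)
    (A : 'I_n -> 'M[R]_2) (hA : forall j : 'I_n, \det (A j) = 1) :
  (((2 * pi)^-1)%:E *
     \int[@lebesgue_measure R]_(theta in `[0%R, (2 * pi)%R])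
        (logN (rotmx_prod A theta))%:E = (\sum_(j < n) logN (A j))%:E)%E.
Proof.
(* The last matrix comes first in [s], as in [rotmx_prod]; reindexing along [rev_ord] restores the
   order of the sum. *)
pose s := [seq A (rev_ord j) | j <- index_enum 'I_n].
have prodE t : rotmx_prod A t = \prod_(M <- s) (M * rotmx t) by rewrite big_map.
under eq_integral do rewrite prodE.
rewrite integral_logN_prod => [|M /mapP[j _ ->]//].
rewrite big_map -EFinM mulKf ?gt_eqF ?twopi_gt0//.
by congr (_%:E); rewrite [RHS](reindex_inj rev_ord_inj).
Qed.
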